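(* Let $p>0$ be a prime, $k$ a field of characteristic $p$, and $G$ an elementary abelian $p$-group of order $q=p^n$ with $n\ge 1$. Let $W$ be a faithful indecomposable $kG$-module of dimension $2$, and for $1\le i\le q$ set $V_i = S^{i-1}(W)^*$. Then: (a) $V_2\otimes V_i\cong V_{i+1}\oplus V_{i-1}$ as $kG$-modules for all integers $1\le i<q$ with $p\nmid i$; (b) if $n>1$, then $V_2\otimes V_p$ is an indecomposable $kG$-module.
   Context: $S^d(W)$ denotes the $d$-th symmetric power of $W$ over $k$ (with $S^0(W)=k$ the trivial module), and $*$ denotes the dual (contragredient) module. Thus $\dim V_i=i$. $V_0$ denotes the zero module. Tensor products are over $k$ with the diagonal action $g(x\otimes y)=gx\otimes gy$. *)

(* Defs.v *)
From HB Require Import structures.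
From mathcomp Require Import all_boot all_order all_algebra all_fingroup.
From mathcomp Require Import all_solvable all_field all_character.
From mathcomp Require Import mpoly.

Set Implicit Arguments.
Unset Strict Implicit.
Unset Printing Implicit Defensive.

Import GroupScope GRing.Theory.
Local Open Scope ring_scope.

(* A kG-module of dimension m is a matrix representation rG of G on the row
   vectors 'rV[k]_m, on which g acts by right multiplication by rG g. *)

Section Modules.

Variables (k : fieldType) (gT : finGroupType) (G : {group gT}).

Definition mx_indecomposable m (rG : mx_representation k G m) : Prop :=
  (0 < m)%N /\
  forall U V : 'M[k]_m, mxmodule rG U -> mxmodule rG V ->
    (U + V :=: 1%:M)%MS -> (U :&: V)%MS = 0 -> U = 0 \/ V = 0.

Section Dual.

Variables (m : nat) (rG : mx_representation k G m).

Lemma dual_mx_repr : mx_repr G (fun g => (rG g^-1%g)^T).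
Proof.
split=> [|g h Gg Gh]; first by rewrite invg1 repr_mx1 trmx1.
by rewrite invMg repr_mxM ?groupV // trmx_mul.
Qed.

(* In the basis dual to the standard one, (f g)(v) = f (v g^-1). *)
Definition dual_repr := MxRepresentation dual_mx_repr.

End Dual.

(* The symmetric algebra of a module with basis e_0, ..., e_m is the polynomial
   ring k[X_0, ..., X_m] with X_i standing for e_i: g acts on it by the algebra
   endomorphism X_i |-> e_i g = \sum_j (rG g)_ij X_j. The d-th symmetric power
   is its component of degree d, namely dhomog m.+1 k d. *)
Section SymmetricPower.

Variables (m : nat) (rG : mx_representation k G m.+1) (d : nat).

Definition sym_subst (g : gT) : m.+1.-tuple {mpoly k[m.+1]} :=
  [tuple \sum_(j < m.+1) rG g i j *: 'X_j | i < m.+1].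

Lemma sym_subst_homog g (P : dhomog m.+1 k d) :
  mpoly_of_dhomog P \mPo sym_subst g \is d.-homog.
Proof.
rewrite comp_mpolyE big_seq rpred_sum // => u u_in; apply: rpredZ.
have /dhomogP/(_ u u_in) <- := dhomog_is_dhomog P.
rewrite /= mdegE.
apply: (big_ind2 (fun (q : {mpoly k[m.+1]}) e => q \is e.-homog)).
- exact: dhomog1.
- by move=> q e q' e'; apply: dhomogM.
move=> i _; suff /(dhomogMn (u i)) : tnth (sym_subst g) i \is 1.-homog.
  by rewrite mul1n.
rewrite tnth_mktuple rpred_sum // => j _.
by apply: rpredZ; rewrite dhomogX /= mdeg1.
Qed.

Definition sym_act g (P : dhomog m.+1 k d) : dhomog m.+1 k d :=
  DHomog (sym_subst_homog g P).

Lemma sym_act_is_linear g : linear (sym_act g).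
Proof. by move=> a P Q; apply: val_inj; rewrite /= linearP. Qed.

HB.instance Definition _ g :=
  GRing.isLinear.Build k (dhomog m.+1 k d) (dhomog m.+1 k d) _ (sym_act g)
    (sym_act_is_linear g).

Definition sym_mx g : 'M[k]_(\dim {:dhomog m.+1 k d}) :=
  passmx.mxof (vbasis fullv) (vbasis fullv) (linfun (sym_act g)).

Lemma sym_act1 P : sym_act 1%g P = P.
Proof.
apply: val_inj => /=; rewrite -[RHS]comp_mpoly_id; congr (_ \mPo _).
apply: eq_from_tnth => i; rewrite !tnth_mktuple repr_mx1 (bigD1 i) //=.
rewrite mxE eqxx scale1r big1 ?addr0 // => j /negPf nji.
by rewrite mxE eq_sym nji scale0r.
Qed.

Lemma sym_actM g h P : g \in G -> h \in G ->
  sym_act (g * h)%g P = sym_act h (sym_act g P).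
Proof.
move=> Gg Gh; apply: val_inj => /=.
rewrite [LHS]comp_mpolyE [X in X \mPo sym_subst h]comp_mpolyE.
rewrite [RHS]raddf_sum /=; apply: eq_bigr => u _.
rewrite linearZ /=; congr (_ *: _).
rewrite rmorph_prod /=; apply: eq_bigr => i _; rewrite rmorphXn /=.
congr (_ ^+ _); rewrite !tnth_mktuple raddf_sum /= repr_mxM //.
under [RHS]eq_bigr => j _.
  rewrite linearZ /= comp_mpolyXU -tnth_nth tnth_mktuple scaler_sumr.
  under eq_bigr do rewrite scalerA; over.
rewrite exchange_big; apply: eq_bigr => l _ /=.
by rewrite mxE scaler_suml.
Qed.

Lemma sym_mx_repr : mx_repr G sym_mx.
Proof.
have bas := vbasisP {:dhomog m.+1 k d}.
split=> [|g h Gg Gh].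
  rewrite -(passmx.mxof1 (basis_free bas)); congr (passmx.mxof _ _ _).
  by apply/lfunP => P; rewrite !lfunE /= sym_act1.
rewrite -passmx.mxof_comp //; congr (passmx.mxof _ _ _).
by apply/lfunP => P; rewrite comp_lfunE !lfunE /= sym_actM.
Qed.

Definition sym_repr := MxRepresentation sym_mx_repr.

End SymmetricPower.

(* V_i = S^(i-1)(W)^* for i > 0, and V_0 = 0. *)
Definition Vmod (rW : mx_representation k G 2) (i : nat) : representation k G :=
  if i is j.+1 then Representation (dual_repr (sym_repr rW j)) else grepr0.

Lemma rdegree_Vmod rW i : rdegree (Vmod rW i) = i.
Proof. case: i => //= j; rewrite dimvf.
by rewrite (_ : dim _ = 'C(j + 1, j)) // addn1 binSn. Qed.

End Modules.

(* Main.v *)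
From HB Require Import structures.
Require Import Defs.
From mathcomp Require Import all_boot all_order all_algebra all_fingroup.
From mathcomp Require Import all_solvable all_field all_character.
From mathcomp Require Import mpoly ring.

Set Implicit Arguments.
Unset Strict Implicit.
Unset Printing Implicit Defensive.

Import GRing.Theory.

(** A p-group in characteristic p fixes a nonzero vector of W and acts on W with
    determinant 1. So W has a basis 1, x on which g acts by x |-> x + a(g) and
    1 |-> 1, for an additive map a : G -> k that is injective because W is
    faithful. Setting the fixed vector of W to 1 turns S^(i-1)(W) into the space
    of polynomials in x of degree less than i, on which g acts by
    f(x) |-> f(x + a(g)) (rsim_sym_trans). Write T_i for this module. Both
    claims are invariant under duality, so they can be proved for T_2 and T_i
    in place of their duals V_2 and V_i. An element of T_2 ⊗ T_i is a pair
    (u1, u0) of polynomials of degree less than i, standing for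
    x ⊗ u1 + 1 ⊗ u0; then g acts by
    (u1, u0) |-> (u1(x + a), u0(x + a) + a u1(x + a)) with a = a(g).

    (a) Multiplication (u1, u0) |-> x u1 + u0 is an equivariant map from
    T_2 ⊗ T_i onto T_(i+1), with kernel isomorphic to T_(i-1) by
    h |-> (h, - x h). The two partial derivatives of the form of degree i that
    corresponds to F give an equivariant map F |-> (F', i F - x F') in the other
    direction, and by Euler's identity the composite is multiplication by i.
    Hence the multiplication map splits when i is nonzero in k
    (trans_prod_rsim_dadd).

    (b) For i = p the vector g w is a polynomial in t = a(g) of degree at
    most p, with coefficients D_j w in T_2 ⊗ T_p. Since n > 1, the map a takes
    more than p values, so by interpolation each D_j is a combination of
    elements of G: submodules are closed under all D_j, and D_j kills the fixed
    vectors for j > 0. The kernel of D_1 has dimension 2, spanned by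
    (1, - x) and (0, 1). If w = (u1, u0) and u1 has the nonzero coefficient lam
    at x ^ (p - 1), then D_p w = (0, lam) and D_(p-1) w is a vector of the
    kernel of D_1 with first component lam, so that every submodule containing w
    contains all fixed vectors. In a decomposition of T_2 ⊗ T_p into
    submodules U and V one of them, say U, contains such a w; then V has no
    nonzero fixed vector, and V = 0 because G is a p-group
    (submod_top_no_complement). *)

(** * Similarity, duality and indecomposability of representations *)

Section Similarity.

Local Open Scope ring_scope.

Variables (k : fieldType) (gT : finGroupType) (G : {group gT}).

(** Isomorphisms are constructed by realizing both modules inside one space E
    with an action of G, for instance a space of polynomials, where equivariance
    is an identity of functions instead of an identity of matrices. It is enough
    to compare the images one way and to know that f1 is injective, because the
    degrees agree. *)
Lemma mx_rsim_embed (E : lmodType k) (act : gT -> E -> E) m1 m2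
    (rG1 : mx_representation k G m1) (rG2 : mx_representation k G m2)
    (f1 : 'rV[k]_m1 -> E) (f2 : 'rV[k]_m2 -> E) :
  m1 = m2 -> linear f1 -> linear f2 -> injective f1 ->
  (forall u, exists v, f1 u = f2 v) ->
  {in G, forall g u, f1 (u *m rG1 g) = act g (f1 u)} ->
  {in G, forall g v, f2 (v *m rG2 g) = act g (f2 v)} ->
  mx_rsim rG1 rG2.
Proof.
move=> def_m1; move: def_m1 rG1 f1 => -> {m1} rG1 f1.
move=> lin1 lin2 inj1 im12 act1 act2.
pose F1 : {linear 'rV[k]_m2 -> E} :=
  HB.pack f1 (GRing.isLinear.Build _ _ _ _ f1 lin1).
pose F2 : {linear 'rV[k]_m2 -> E} :=
  HB.pack f2 (GRing.isLinear.Build _ _ _ _ f2 lin2).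
have [b bP] := fin_all_exists (fun i : 'I_m2 => im12 'e_i).
pose B : 'M[k]_m2 := \matrix_i b i.
have f12 u : f1 u = f2 (u *m B).
  rewrite [in LHS](row_sum_delta u) mulmx_sum_row.
  rewrite -[LHS]/(F1 _) -[RHS]/(F2 _) !linear_sum; apply: eq_bigr => i _.
  by rewrite !linearZ rowK /= bP.
have Bunit : B \in unitmx.
  rewrite -row_free_unit; apply: inj_row_free => u uB0; apply: inj1.
  by rewrite f12 uB0 -[LHS]/(F2 0) -[RHS]/(F1 0) !linear0.
(* f2 equals f1 after the base change by B^-1, so it is injective as well. *)
have inj2 : injective f2.
  move=> u v; rewrite -[u](mulmxKV Bunit) -[v](mulmxKV Bunit) -!f12.
  by move/inj1->.
exists B => // [|g Gg]; first by rewrite row_free_unit.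
apply/row_matrixP => i; rewrite !rowE !mulmxA.
by apply: inj2; rewrite -f12 act1 // f12 act2.
Qed.

Lemma mx_rsim_dual m1 m2 (rG1 : mx_representation k G m1)
    (rG2 : mx_representation k G m2) :
  mx_rsim rG1 rG2 -> mx_rsim (dual_repr rG1) (dual_repr rG2).
Proof.
case=> B def_m1; move: def_m1 rG1 B => -> {m1} rG1 B.
rewrite row_free_unit => Bunit simB; apply: mx_rsim_sym.
exists B^T => // [|g Gg]; first by rewrite row_free_unit unitmx_tr.
by rewrite /= -!trmx_mul simB ?groupV.
Qed.

Lemma mx_rsim_prod m1 m2 n1 n2 (rG1 : mx_representation k G m1)
    (rG2 : mx_representation k G m2) (rH1 : mx_representation k G n1)
    (rH2 : mx_representation k G n2) :
  mx_rsim rG1 rG2 -> mx_rsim rH1 rH2 ->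
  mx_rsim (prod_repr rG1 rH1) (prod_repr rG2 rH2).
Proof.
case=> B def_m1; move: def_m1 rG1 B => -> {m1} rG1 B freeB simB.
case=> C def_n1; move: def_n1 rH1 C => -> {n1} rH1 C freeC simC.
exists (tprod B C) => // [|g Gg]; last by rewrite /= -!tprodE simB ?simC.
move: freeB freeC; rewrite !row_free_unit => uB uC.
have : tprod B C *m tprod (invmx B) (invmx C) = 1%:M.
  by rewrite -tprodE !mulmxV // tprod1.
by case/mulmx1_unit.
Qed.

Lemma mx_rsim_dadd (rG1 rG2 rH1 rH2 : representation k G) :
  mx_rsim rG1 rG2 -> mx_rsim rH1 rH2 ->
  mx_rsim (dadd_grepr rG1 rH1) (dadd_grepr rG2 rH2).
Proof.
case=> B eqG freeB simB [C eqH freeC simC].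
exists (block_mx B 0 0 C) => /= [||g Gg]; first by rewrite eqG eqH.
  apply: inj_row_free => v; rewrite -[v]hsubmxK mul_row_block.
  rewrite !mulmx0 addr0 add0r.
  rewrite -[X in _ = X -> _]row_mx0 => /eq_row_mx[/eqP uB0 /eqP uC0].
  move: uB0 uC0; rewrite !mulmx_free_eq0 // => /eqP-> /eqP->; exact: row_mx0.
by rewrite !mulmx_block !(mulmx0, mul0mx, addr0, add0r) simB // simC.
Qed.

Lemma dual_dadd (rG1 rG2 : representation k G) :
  mx_rsim (dadd_grepr (Representation (dual_repr rG1))
             (Representation (dual_repr rG2)))
    (dual_repr (dadd_grepr rG1 rG2)).
Proof.
exists 1%:M => // [|g Gg]; first by rewrite row_free_unit unitmx1.
by rewrite mulmx1 mul1mx /= tr_block_mx !trmx0.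
Qed.

(** The recursion that defines tprod ends with blocks of width 0 and height 0,
    which remain visible in the block decomposition. *)
Lemma tprod2 m n (A : 'M[k]_2) (B : 'M[k]_(m, n)) :
  tprod A B = block_mx (A 0 0 *: B) (row_mx (A 0 1 *: B) 0)
    (col_mx (A 1 0 *: B) 0) (block_mx (A 1 1 *: B) 0 0 0).
Proof.
have zeroE : lshift 1 (0 : 'I_1) = 0 :> 'I_2 by apply: val_inj.
have oneE : rshift 1 (lshift 0 (0 : 'I_1)) = 1 :> 'I_2 by apply: val_inj.
rewrite /= !mxE zeroE oneE.
rewrite /block_mx row_mx0; congr col_mx.
by rewrite -block_mxEh /block_mx row_mx0.
Qed.

Lemma dual_prod2 m (rG1 : mx_representation k G 2)
    (rG2 : mx_representation k G m) :
  mx_rsim (prod_repr (dual_repr rG1) (dual_repr rG2))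
    (dual_repr (prod_repr rG1 rG2)).
Proof.
exists 1%:M => // [|g Gg]; first by rewrite row_free_unit unitmx1.
rewrite mulmx1 mul1mx.
change (tprod (rG1 g^-1%g)^T (rG2 g^-1%g)^T =
  (tprod (rG1 g^-1%g) (rG2 g^-1%g))^T).
rewrite !tprod2 !tr_block_mx tr_row_mx tr_col_mx.
by rewrite !linearZ /= !trmx0 !mxE.
Qed.

(** Direct decompositions correspond to idempotent endomorphisms. This form of
    indecomposability is a statement on matrices, and so passes to the transposed
    and to the conjugated representation. *)
Lemma mx_indecomposable_idem m (rG : mx_representation k G m) :
  mx_indecomposable rG <->
  (0 < m)%N /\ forall P : 'M[k]_m, P *m P = P ->
    {in G, forall g, rG g *m P = P *m rG g} -> P = 0 \/ P = 1%:M.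
Proof.
split=> -[m_gt0 indec]; split=> //.
- move=> P idemP comP.
  have modI Q : {in G, forall g, rG g *m Q = Q *m rG g} -> mxmodule rG Q.
    by move=> comQ; apply/mxmoduleP => g Gg; rewrite -comQ // submxMl.
  have comP' : {in G, forall g, rG g *m (1%:M - P) = (1%:M - P) *m rG g}.
    by move=> g Gg; rewrite mulmxBl mulmxBr mul1mx mulmx1 comP.
  case: (indec P (1%:M - P)) => [|||||]; auto.
  + by apply/eqmxP; rewrite submx1 -[X in (X <= _)%MS](subrKC P) addmx_sub_adds.
  + apply/eqP; rewrite -submx0; apply/rV_subP => u; rewrite sub_capmx.
    case/andP=> /submxP[v ->] /submxP[w] vP.
    have -> : v *m P = (v *m P) *m P by rewrite -mulmxA idemP.
    by rewrite vP -mulmxA mulmxBl mul1mx idemP subrr mulmx0 sub0mx.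
  by move/eqP; rewrite subr_eq0 => /eqP; right.
move=> U V modU modV UV1 UV0.
have idemP : proj_mx U V *m proj_mx U V = proj_mx U V by apply: proj_mx_proj.
have full (W : 'M[k]_m) : (W <= U + V)%MS by rewrite UV1 submx1.
have comP : {in G, forall g, rG g *m proj_mx U V = proj_mx U V *m rG g}.
  move=> g Gg; rewrite -[RHS]mul1mx mulmxA -[in LHS](mul1mx (rG g)).
  apply/hom_mxP: g Gg; apply: submx_trans (proj_mx_hom UV0 modU modV).
  exact: full.
case: (indec _ idemP comP) => [P0 | P1]; [left | right].
  by rewrite -(proj_mx_id UV0 (submx_refl U)) P0 mulmx0.
by rewrite -[V]mulmx1 -P1 (proj_mx_0 UV0 (submx_refl V)).
Qed.

Lemma mx_indecomposable_dual m (rG : mx_representation k G m) :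
  mx_indecomposable rG -> mx_indecomposable (dual_repr rG).
Proof.
move/mx_indecomposable_idem=> [m_gt0 indec].
apply/mx_indecomposable_idem; split=> // P idemP comP.
case: (indec P^T) => [|g Gg||].
- by rewrite -trmx_mul idemP.
- have := comP _ (groupVr Gg); rewrite /= invgK => /(congr1 trmx).
  by rewrite !trmx_mul trmxK.
- by move/(congr1 trmx); rewrite trmxK trmx0; left.
by move/(congr1 trmx); rewrite trmxK trmx1; right.
Qed.

Lemma mx_indecomposable_rsim m1 m2 (rG1 : mx_representation k G m1)
    (rG2 : mx_representation k G m2) :
  mx_rsim rG1 rG2 -> mx_indecomposable rG1 -> mx_indecomposable rG2.
Proof.
case=> B def_m1; move: def_m1 rG1 B => -> {m1} rG1 B.
rewrite row_free_unit => Bunit simB.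
move/mx_indecomposable_idem=> [m_gt0 indec].
apply/mx_indecomposable_idem; split=> // P idemP comP.
case: (indec (B *m P *m invmx B)) => [|g Gg||].
- by rewrite -!mulmxA (mulKmx Bunit) (mulmxA P) idemP.
- rewrite !mulmxA simB // -(mulmxA B (rG2 g)) comP // -!mulmxA.
  congr (_ *m (_ *m _)).
  by apply: (canRL (mulKmx Bunit)); rewrite mulmxA -simB // mulmxK.
- move/(canRL (mulmxKV Bunit)); rewrite mul0mx => /(canRL (mulKmx Bunit)).
  by rewrite mulmx0; left.
move/(canRL (mulmxKV Bunit)); rewrite mul1mx => /(canRL (mulKmx Bunit)).
by rewrite mulVmx //; right.
Qed.

End Similarity.

(** * Polynomials under translation *)

Section Translation.

Local Open Scope ring_scope.

Variable k : fieldType.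

(** The matrix of f(x) |-> f(x + c) on the polynomials of degree less than m, in
    the basis 1, x, ..., x ^ (m - 1). *)
Definition trans_mx m (c : k) : 'M[k]_m :=
  lin1_mx (fun v => poly_rV (rVpoly v \Po ('X + c%:P))).

Lemma size_trans (f : {poly k}) c : size (f \Po ('X + c%:P)) = size f.
Proof. by apply: size_comp_poly2; rewrite size_XaddC. Qed.

Lemma size_rVpoly m (v : 'rV[k]_m) : (size (rVpoly v) <= m)%N.
Proof. exact: size_poly. Qed.

Lemma mul_trans_mx m c (v : 'rV[k]_m) :
  rVpoly (v *m trans_mx m c) = rVpoly v \Po ('X + c%:P).
Proof.
rewrite (mul_rV_lin1 (@poly_rV k m \o comp_poly ('X + c%:P) \o rVpoly)) /=.
by rewrite poly_rV_K // size_trans size_rVpoly.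
Qed.

Lemma trans_mxE m c (i j : 'I_m) :
  trans_mx m c i j = (('X + c%:P) ^+ i)`_j.
Proof. by rewrite !mxE rVpoly_delta comp_Xn_poly. Qed.

Lemma trans_mx2 (c : k) : [/\ trans_mx 2 c 0 0 = 1, trans_mx 2 c 0 1 = 0,
  trans_mx 2 c 1 0 = c & trans_mx 2 c 1 1 = 1].
Proof.
by split; rewrite trans_mxE ?expr0 ?expr1 ?coef1 ?coefD ?coefX ?coefC //=
  ?add0r ?addr0.
Qed.

Variables (gT : finGroupType) (G : {group gT}) (a : gT -> k).
Hypothesis aD : {in G &, {morph a : g h / (g * h)%g >-> g + h}}.

Lemma trans_mx_repr m : mx_repr G (fun g => trans_mx m (a g)).
Proof.
have a1 : a 1%g = 0.
  by apply: (addIr (a 1%g)); rewrite add0r -aD // mulg1.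
split=> [|g h Gg Gh]; apply/row_matrixP => i; rewrite !rowE ?mulmxA;
  apply: (can_inj rVpolyK); rewrite !mul_trans_mx.
  by rewrite a1 addr0 comp_polyXr mulmx1.
rewrite -comp_polyA; congr (_ \Po _).
by rewrite comp_polyD comp_polyX comp_polyC aD // polyCD addrA addrAC.
Qed.

Definition trans_repr m := MxRepresentation (trans_mx_repr m).

End Translation.

(** * Faithful modules of dimension 2 *)

Section TwoDimensional.

Local Open Scope ring_scope.

Variables (p : nat) (k : fieldType) (gT : finGroupType) (G : {group gT}).
Variable rW : mx_representation k G 2.
Hypotheses (k_char : p \in [pchar k]) (pG : (p.-group G)%g).

(** 1 is the only root of unity in k whose order is a power of p. *)
Lemma unimodular_pgroup m (rG : mx_representation k G m) g :
  g \in G -> \det (rG g) = 1.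
Proof.
move=> Gg; have detX j : \det (rG (g ^+ j)%g) = \det (rG g) ^+ j.
  elim: j => [|j IHj]; first by rewrite repr_mx1 det1.
  by rewrite expgS repr_mxM ?groupX // det_mulmx IHj exprS.
have [n ogn] := p_natP (mem_p_elt pG Gg).
have := detX #[g]%g; rewrite expg_order repr_mx1 det1 ogn => /esym detg1.
have charn : ([pchar k].-nat (p ^ n))%N.
  by rewrite pnatX pnatE ?(pcharf_prime k_char) ?k_char.
have /eqP := exprDn_pchar 1 (\det (rG g) - 1) charn.
rewrite subrKC detg1 expr1n -subr_eq0 opprD addrA subrr add0r oppr_eq0.
by rewrite expf_eq0 subr_eq0 => /andP[_ /eqP].
Qed.

(** In a basis that starts with a fixed vector every rW g is triangular, with
    diagonal entries 1 and det (rW g) = 1. *)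
Lemma faithful2_rsim_trans :
  mx_faithful rW -> exists a : gT -> k,
    exists aD : {in G &, {morph a : g h / (g * h)%g >-> g + h}},
      {in G &, injective a} /\ mx_rsim rW (trans_repr aD 2).
Proof.
move=> faithW.
have /rowV0Pn[v v_fix nz_v] :=
  rfix_pgroup_pchar k_char rW (ltn0Sn 1) pG (subxx G).
have [B Bunit vB] : {B : 'M[k]_2 | B \in unitmx & 'e_0 *m B = v}.
  have := @complete_unitmx _ 1 2 'e_0 (\matrix_i if i == 0 then v else 0).
  rewrite -rowE rowK /= => /(_ _)[|B Bunit ->]; last by exists B.
  by rewrite rank_rV nz_v mxrank_delta.
pose C g := B *m rW g *m invmx B.
have CM : {in G &, {morph C : g h / (g * h)%g >-> g *m h}}.
  by move=> g h Gg Gh; rewrite /C repr_mxM // !mulmxA mulmxKV.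
have CB g : C g *m B = B *m rW g by rewrite mulmxKV.
have C0 g j : g \in G -> C g 0 j = (0 == j)%:R.
  move=> Gg; have e0C : 'e_0 *m C g = 'e_0 :> 'rV_2.
    rewrite /C !mulmxA vB (rfix_mxP _ v_fix) //.
    by rewrite -vB mulmxK.
  by move: e0C; rewrite -rowE => /rowP/(_ j); rewrite !mxE eqxx [j == _]eq_sym.
have C11 g : g \in G -> C g 1 1 = 1.
  move=> Gg; have : \det (C g) = 1.
    rewrite !det_mulmx mulrAC -det_mulmx mulmxV // det1 mul1r.
    exact: unimodular_pgroup.
  rewrite (expand_det_row _ 0) !big_ord_recl big_ord0 !C0 //= mul1r mul0r.
  rewrite !addr0.
  rewrite /cofactor det_mx11 expr0 mul1r 2!mxE => <-.
  by congr (C g _ _); apply: val_inj.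
pose a g := C g 1 0.
have aD : {in G &, {morph a : g h / (g * h)%g >-> g + h}}.
  move=> g h Gg Gh; rewrite /a CM // mxE !big_ord_recl big_ord0.
  rewrite C0 // (_ : lift _ _ = 1); last exact: val_inj.
  by rewrite C11 // mulr1 mul1r addr0.
have Ctrans g : g \in G -> C g = trans_mx 2 (a g).
  move=> Gg; apply/matrixP => i j; have [t00 t01 t10 t11] := trans_mx2 (a g).
  have ord2 (l : 'I_2) : l = 0 \/ l = 1.
    by case: l => -[|[|//]] ltl; [left | right]; apply: val_inj.
  have [->|->] := ord2 i; first by rewrite C0 //; have [->|->] := ord2 j.
  by have [->|->] := ord2 j; rewrite ?C11.
have simB : mx_rsim rW (trans_repr aD 2).
  apply: mx_rsim_sym; exists B => // [|g Gg]; first by rewrite row_free_unit.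
  by rewrite /= -Ctrans // CB.
exists a, aD; split=> // g h Gg Gh eq_agh.
move: faithW; rewrite (mx_rsim_faithful simB) => /mx_faithful_inj.
by apply=> //=; rewrite eq_agh.
Qed.

End TwoDimensional.

(** * Symmetric powers as spaces of polynomials in one variable *)

Section SymmetricPowers.

Local Open Scope ring_scope.

Variables (k : fieldType) (gT : finGroupType) (G : {group gT}).
Variables (rW : mx_representation k G 2) (a : gT -> k).
Hypothesis aD : {in G &, {morph a : g h / (g * h)%g >-> g + h}}.

(** The realization is evaluation: the basis vectors e_0, e_1 of W are sent to the
    linear polynomials ell B 0, ell B 1 that they become in the model of W, and
    a form of degree d in e_0, e_1 to the corresponding polynomial. The basis of
    W is arbitrary here, so that surjectivity is easier to see than injectivity;
    the latter follows from it because the dimensions agree. *)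
Lemma rsim_sym_trans d :
  mx_rsim rW (trans_repr aD 2) ->
  mx_rsim (sym_repr rW d) (trans_repr aD d.+1).
Proof.
case=> B _; rewrite row_free_unit => Bunit simB.
pose ell (M : 'M[k]_2) i := rVpoly (row i M).
pose ev : {mpoly k[2]} -> {poly k} := mmap (@polyC k) (ell B).
have evZ c P : ev (c *: P) = c *: ev P by rewrite /ev mmapZ mul_polyC.
have ev_lin (M : 'M[k]_2) i :
    ev (\sum_j M i j *: 'X_j) = ell (M *m B) i.
  rewrite /ell row_mul mulmx_sum_row [ev _]raddf_sum linear_sum.
  apply: eq_bigr => j _; rewrite -[LHS]/(ev _) evZ [ev _]mmapX mmap1U.
  by rewrite linearZ mxE.
have ev_subst g P : g \in G ->
    ev (P \mPo sym_subst rW g) = ev P \Po ('X + (a g)%:P).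
  move=> Gg; rewrite comp_mpolyE [ev _]raddf_sum [RHS]raddf_sum /=.
  apply: eq_bigr => m _; rewrite -[LHS]/(ev _) evZ /=.
  rewrite rmorphM /= comp_polyC mul_polyC; congr (_ *: _).
  rewrite [LHS]rmorph_prod rmorph_prod; apply: eq_bigr => i _ /=.
  rewrite [LHS]rmorphXn rmorphXn /= -[mmap _ _]/ev tnth_mktuple ev_lin simB //=.
  by rewrite /ell row_mul mul_trans_mx.
have bas := vbasisP {:dhomog 2 k d}.
apply: mx_rsim_sym.
pose f (v : 'rV_(\dim {:dhomog 2 k d})) : {poly k} :=
  ev (mpoly_of_dhomog (passmx.vecof (vbasis fullv) v)).
apply: (mx_rsim_embed (act := fun g (q : {poly k}) => q \Po ('X + (a g)%:P))
  (f1 := rVpoly) (f2 := f)).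
- by have := rdegree_Vmod rW d.+1.
- exact: linearP.
- by move=> c u v; rewrite /f passmx.vecof_linear -evZ [LHS]raddfD.
- exact: can_inj rVpolyK.
- move=> u.
  pose q i : {mpoly k[2]} := \sum_j invmx B i j *: 'X_j.
  have evq i : ev (q i) = 'X^i.
    by rewrite ev_lin mulVmx // /ell row1 rVpoly_delta.
  have hq i : q i \is 1.-homog.
    by apply: rpred_sum => j _; apply: rpredZ; rewrite dhomogX /= mdeg1.
  (* q 0 and q 1 are the elements of W that evaluate to 1 and x, so that
     q 1 ^+ j * q 0 ^+ (d - j) evaluates to x ^ j. *)
  pose P : {mpoly k[2]} :=
    \sum_(j < d.+1) u 0 j *: (q 1 ^+ j * q 0 ^+ (d - j)).
  have hP : P \is d.-homog.
    apply: rpred_sum => j _; apply: rpredZ.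
    have := dhomogM (dhomogMn j (hq 1)) (dhomogMn (d - j) (hq 0)).
    by rewrite !mul1n subnKC // -ltnS.
  exists (passmx.rVof (vbasis fullv) (DHomog hP)).
  rewrite /f passmx.rVofK //= [RHS]raddf_sum [u in LHS]row_sum_delta linear_sum.
  apply: eq_bigr => j _; rewrite -[RHS]/(ev _) evZ linearZ /= rVpoly_delta.
  congr (_ *: _); rewrite [RHS]rmorphM rmorphXn rmorphXn /= -[mmap _ _]/ev.
  by rewrite !evq expr1n mulr1 expr1.
- by move=> g Gg u; rewrite mul_trans_mx.
move=> g Gg v; rewrite /f passmx.mul_mxof passmx.rVofK // lfunE /=.
exact: ev_subst.
Qed.

End SymmetricPowers.

(** * The tensor product with the module of linear polynomials *)

Section LinearPolynomialPairs.

Local Open Scope ring_scope.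

Variable k : fieldType.

(** The pair q stands for x ⊗ q.1 + 1 ⊗ q.2, and x |-> x + c, 1 |-> 1 in the
    first tensor factor. *)
Definition pair_trans (c : k) (q : {poly k} * {poly k}) : {poly k} * {poly k} :=
  (q.1 \Po ('X + c%:P), q.2 \Po ('X + c%:P) + c *: (q.1 \Po ('X + c%:P))).

(** The basis of the first factor is 1, x, so the first block of coordinates
    belongs to 1; an empty block closes the product 2 * m. *)
Definition pair_of_rV m (w : 'rV[k]_(2 * m)) : {poly k} * {poly k} :=
  (rVpoly (lsubmx (rsubmx (w : 'rV_(m + (m + 0))))),
   rVpoly (lsubmx (w : 'rV_(m + (m + 0))))).

Lemma pair_of_rV_linear m : linear (@pair_of_rV m).
Proof. by move=> c u v; rewrite /pair_of_rV !linearP. Qed.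

HB.instance Definition _ m :=
  GRing.isLinear.Build k 'rV[k]_(2 * m) ({poly k} * {poly k})%type _
    (@pair_of_rV m) (@pair_of_rV_linear m).

Lemma pair_of_rV_inj m : injective (@pair_of_rV m).
Proof.
move=> u v [/(can_inj rVpolyK) eq1 /(can_inj rVpolyK) eq0].
rewrite -[u](@hsubmxK _ 1 m (m + 0)) -[v](@hsubmxK _ 1 m (m + 0)) eq0.
rewrite -[rsubmx u]hsubmxK -[rsubmx v]hsubmxK eq1.
by congr (row_mx _ (row_mx _ _)); apply/rowP; case.
Qed.

Lemma size_pair_of_rV m (w : 'rV[k]_(2 * m)) :
  (size (pair_of_rV w).1 <= m)%N /\ (size (pair_of_rV w).2 <= m)%N.
Proof. by split; apply: size_rVpoly. Qed.

Lemma pair_of_rV_onto m (q : {poly k} * {poly k}) :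
  (size q.1 <= m)%N -> (size q.2 <= m)%N ->
  exists w : 'rV_(2 * m), pair_of_rV w = q.
Proof.
case: q => q1 q0 /= sz1 sz0.
exists (row_mx (poly_rV q0) (row_mx (poly_rV q1) 0)).
by rewrite /pair_of_rV row_mxKr !row_mxKl !poly_rV_K.
Qed.

Variables (gT : finGroupType) (G : {group gT}) (a : gT -> k).
Hypothesis aD : {in G &, {morph a : g h / (g * h)%g >-> g + h}}.

Lemma pair_of_rV_trans m g (w : 'rV[k]_(2 * m)) :
  pair_of_rV (w *m prod_repr (trans_repr aD 2) (trans_repr aD m) g) =
  pair_trans (a g) (pair_of_rV w).
Proof.
change (pair_of_rV (w *m tprod (trans_mx 2 (a g)) (trans_mx m (a g))) =
  pair_trans (a g) (pair_of_rV w)).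
have [t00 t01 t10 t11] := trans_mx2 (a g).
rewrite tprod2 t00 t01 t10 t11 !scale1r scale0r row_mx0.
rewrite -[w in LHS](@hsubmxK _ 1 m (m + 0)) -[rsubmx w in LHS]hsubmxK.
rewrite mul_row_block mul_row_col mul_row_block !mulmx0 add0r !addr0.
rewrite /pair_of_rV row_mxKr !row_mxKl linearD /= -scalemxAr linearZ /=.
by rewrite !mul_trans_mx.
Qed.

(** The first summand is embedded by the two partial derivatives, which in the
    variable x read F |-> (F', i F - x F'), and the second one as the kernel
    h |-> (h, - x h) of multiplication. *)
Lemma trans_prod_rsim_dadd i :
  (0 < i)%N -> i%:R != 0 :> k ->
  mx_rsim (prod_repr (trans_repr aD 2) (trans_repr aD i))
    (dadd_grepr (Representation (trans_repr aD i.+1))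
       (Representation (trans_repr aD i.-1))).
Proof.
move=> i_gt0 nz_i.
pose f (w : 'rV[k]_(i.+1 + i.-1)) : {poly k} * {poly k} :=
  let F := rVpoly (lsubmx w) in let h := rVpoly (rsubmx w) in
  (F^`() + h, i%:R *: F - 'X * (F^`() + h)).
apply: (mx_rsim_embed (act := fun g => pair_trans (a g))
  (f1 := @pair_of_rV i) (f2 := f)).
- by rewrite /= mul2n -addnn addSnnS prednK.
- exact: linearP.
- move=> c u v; rewrite /f !linearP /=.
  by congr (_, _); rewrite /= -!mul_polyC; ring.
- exact: pair_of_rV_inj.
- (* Multiplication sends f w = (u1, u0) to x u1 + u0 = i F; this determines F,
     and then h = u1 - F'. *)
  move=> u; have := size_pair_of_rV u.
  case: (pair_of_rV u) => u1 u0 [/= sz1 sz0].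
  pose F := i%:R^-1 *: ('X * u1 + u0).
  have szF : (size F <= i.+1)%N.
    apply/leq_sizeP => j lt_ij; rewrite coefZ coefD coefXM.
    case: j lt_ij => // j lt_ij.
    rewrite !nth_default ?addr0 ?mulr0 // ?(leq_trans sz1) //.
    by rewrite (leq_trans sz0) // ltnW.
  have szh : (size (u1 - F^`())%R <= i.-1)%N.
    (* The two coefficients of x ^ (i - 1) cancel. *)
    apply/leq_sizeP => j le_ij; rewrite coefB coef_deriv coefZ coefD coefXM /=.
    rewrite (nth_default _ (_ : size u0 <= j.+1)%N); last first.
      by apply: leq_trans sz0 _; rewrite -ltnS (prednK i_gt0) in le_ij *.
    have [lt_ij | le_ji] := ltnP i j.+1.
      by rewrite nth_default ?(leq_trans sz1) // addr0 mulr0 mul0rn subr0.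
    have <- : i = j.+1.
      by apply/eqP; rewrite eqn_leq le_ji -(prednK i_gt0) ltnS le_ij.
    by rewrite addr0 -[X in _ - X]mulr_natr mulrAC mulVf // mul1r subrr.
  exists (row_mx (poly_rV F) (poly_rV (u1 - F^`()))).
  rewrite /f row_mxKl row_mxKr !poly_rV_K // subrKC; congr (_, _).
  by rewrite /F scalerA divff // scale1r addrAC subrr add0r.
- by move=> g Gg w; rewrite pair_of_rV_trans.
move=> g Gg w; rewrite /f /= -[w in LHS]hsubmxK mul_row_block !mulmx0.
rewrite addr0 add0r row_mxKl row_mxKr !mul_trans_mx deriv_comp.
rewrite derivD derivX derivC addr0 mulr1.
rewrite /pair_trans /= -comp_polyD; congr (_, _).
rewrite comp_polyB comp_polyM comp_polyX comp_polyZ -!mul_polyC; ring.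
Qed.

Lemma comp_poly_XaddC_taylor n (q : {poly k}) c :
  (size q <= n)%N -> q \Po ('X + c%:P) = \sum_(j < n) c ^+ j *: q^`N(j).
Proof.
move=> szq; rewrite /comp_poly (nderiv_taylor_wide (n := n)); last 2 first.
- exact: mulrC.
- by rewrite size_map_polyC.
apply: eq_bigr => j _; rewrite nderivn_map -/(comp_poly _ _) comp_polyXr.
by rewrite -mul_polyC polyC_exp mulrC.
Qed.

(** The coefficient of c ^ j in pair_trans c q; the factor c in front of the last
    term of pair_trans shifts the index of one of the summands by 1. *)
Definition pair_taylor (j : nat) (q : {poly k} * {poly k}) :
    {poly k} * {poly k} :=
  (q.1^`N(j), q.2^`N(j) + if j is l.+1 then q.1^`N(l) else 0).

Lemma pair_trans_taylor n (q : {poly k} * {poly k}) c :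
  (size q.1 <= n)%N -> (size q.2 <= n)%N ->
  pair_trans c q = \sum_(j < n.+1) c ^+ j *: pair_taylor j q.
Proof.
move=> sz1 sz2; rewrite [RHS]surjective_pairing !raddf_sum /=; congr (_, _).
  by rewrite (comp_poly_XaddC_taylor c (leqW sz1)).
under [RHS]eq_bigr do rewrite scalerDr.
rewrite big_split /= -(comp_poly_XaddC_taylor c (leqW sz2)); congr (_ + _).
rewrite big_ord_recl scaler0 add0r (comp_poly_XaddC_taylor c sz1) scaler_sumr.
by apply: eq_bigr => j _; rewrite scalerA exprS.
Qed.

Lemma deriv_nderivn n (q : {poly k}) : (q^`N(n))^`() = q^`N(n.+1) *+ n.+1.
Proof.
apply/polyP => i; rewrite coefMn coef_deriv !coef_nderivn addnS addSn -!mulrnA.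
congr (_ *+ _); rewrite -[RHS]mulnC mul_bin_left subSn ?leq_addr // addKn.
exact: mulnC.
Qed.

Lemma pair_taylor1 (q : {poly k} * {poly k}) :
  pair_taylor 1 q = (q.1^`(), q.2^`() + q.1).
Proof. by rewrite /pair_taylor !poly.nderivn1 nderivn0. Qed.

(** Translations add up, hence the coefficients of their Taylor expansion multiply
    like divided powers. *)
Lemma pair_taylor1_comp j (q : {poly k} * {poly k}) :
  pair_taylor 1 (pair_taylor j q) = pair_taylor j.+1 q *+ j.+1.
Proof.
rewrite pair_taylor1 [RHS]surjective_pairing !raddfMn /= derivD !deriv_nderivn.
congr (_, _); rewrite mulrnDl -addrA; congr (_ + _).
by case: j => [|j]; rewrite ?derivC ?add0r // deriv_nderivn -mulrSr.
Qed.

Lemma nderivn_top m (q : {poly k}) :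
  (size q <= m.+1)%N -> q^`N(m) = (q`_m)%:P.
Proof.
move=> szq; apply/polyP => -[|i]; rewrite coef_nderivn coefC /= ?addn0 ?binn //.
by rewrite nth_default ?mul0rn // (leq_trans szq) // addnS ltnS leq_addr.
Qed.

Lemma pair_taylor_top m (q : {poly k} * {poly k}) :
  (size q.1 <= m.+1)%N -> (size q.2 <= m.+1)%N ->
  pair_taylor m.+1 q = (0, (q.1`_m)%:P).
Proof.
move=> sz1 sz2; rewrite /pair_taylor (nderivn_poly0 sz1) (nderivn_poly0 sz2).
by rewrite add0r nderivn_top.
Qed.

End LinearPolynomialPairs.

(** * Indecomposability *)

Section Indecomposable.

Local Open Scope ring_scope.

(** The coefficients of a polynomial with values in E are combinations of its
    values at N distinct points, by the inverse of a Vandermonde matrix. *)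
Lemma interpolation (k : fieldType) N (s : 'I_N -> k) :
  injective s -> exists c : 'I_N -> 'I_N -> k,
    forall (E : lmodType k) (e : 'I_N -> E) j,
      \sum_i c j i *: (\sum_(l < N) s i ^+ l *: e l) = e j.
Proof.
move=> inj_s; pose V := Vandermonde N (\row_i s i).
have Vunit : V \in unitmx.
  rewrite unitmxE unitfE det_Vandermonde; apply/prodf_neq0 => i _.
  apply/prodf_neq0 => j lt_ij; rewrite !mxE subr_eq0 (inj_eq inj_s).
  by rewrite -val_eqE gtn_eqF.
exists (fun j i => invmx V i j) => E e j.
under eq_bigr do rewrite scaler_sumr; rewrite exchange_big /= (bigD1 j) //=.
have VV (l : 'I_N) :
    \sum_i invmx V i j *: (s i ^+ l *: e l) = (l == j)%:R *: e l.
  transitivity ((V *m invmx V) l j *: e l); last by rewrite mulmxV // mxE.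
  rewrite mxE scaler_suml; apply: eq_bigr => i _.
  by rewrite scalerA !mxE mulrC.
rewrite VV eqxx scale1r big1 ?addr0 // => l /negPf neq_lj.
by rewrite VV neq_lj scale0r.
Qed.

Variables (p : nat) (k : fieldType) (gT : finGroupType) (G : {group gT}).
Variable a : gT -> k.
Hypothesis aD : {in G &, {morph a : g h / (g * h)%g >-> g + h}}.
Hypotheses (k_char : p \in [pchar k]) (pG : (p.-group G)%g).
Hypotheses (a_inj : {in G &, injective a}) (ltpG : (p < #|G|)%N).

Let rG := prod_repr (trans_repr aD 2) (trans_repr aD p).

(** The vector w rG(g) is a polynomial of degree at most p in a(g), and a takes
    p + 1 distinct values, so that its coefficients lie in the span of the orbit
    of w. The second equation is the case of a constant polynomial. *)
Lemma pair_taylor_orbit : exists c : 'I_p.+1 -> 'I_p.+1 -> k,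
  exists2 x : 'I_p.+1 -> gT, forall i, x i \in G &
  forall (w : 'rV[k]_(2 * p)) j,
    pair_of_rV (\sum_i c j i *: (w *m rG (x i))) = pair_taylor j (pair_of_rV w)
    /\ \sum_i c j i = (j == 0)%:R.
Proof.
pose x (i : 'I_p.+1) := enum_val (widen_ord ltpG i).
have xG i : x i \in G by apply: enum_valP.
have inj_ax : injective (a \o x).
  move=> i j /(a_inj (xG i) (xG j))/enum_val_inj/(congr1 val) /= eq_ij.
  exact: val_inj.
have [c cP] := interpolation inj_ax; exists c, x => // w j; split.
  have [sz1 sz0] := size_pair_of_rV w.
  rewrite linear_sum -[RHS](cP _ (fun l => pair_taylor l (pair_of_rV w)) j).
  apply: eq_bigr => i _; rewrite linearZ; congr (_ *: _).
  by rewrite [LHS]pair_of_rV_trans (pair_trans_taylor _ sz1 sz0).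
rewrite -[RHS](cP k^o (fun l => (l == 0)%:R) j); apply: eq_bigr => i _.
rewrite (bigD1 0) //= expr0 scale1r big1 => [|l /negPf->]; last first.
  exact: scaler0.
by rewrite addr0; exact/esym/mulr1.
Qed.

Lemma pair_taylor_submod (U : 'M_(2 * p)) (w : 'rV[k]_(2 * p)) (j : 'I_p.+1) :
  mxmodule rG U -> (w <= U)%MS ->
  exists2 w' : 'rV_(2 * p),
    (w' <= U)%MS & pair_of_rV w' = pair_taylor j (pair_of_rV w).
Proof.
move=> modU wU; have [c [x xG cP]] := pair_taylor_orbit.
exists (\sum_i c j i *: (w *m rG (x i))); last by case: (cP w j).
by apply: summx_sub => i _; apply/scalemx_sub/(mxmodule_trans modU).
Qed.

Lemma pair_taylor_fix (w : 'rV[k]_(2 * p)) (j : 'I_p.+1) :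
  {in G, forall g, w *m rG g = w} -> j != 0 -> pair_taylor j (pair_of_rV w) = 0.
Proof.
move=> w_fix nz_j; have [c [x xG cP]] := pair_taylor_orbit.
have [<- c0] := cP w j; under eq_bigr do rewrite w_fix //.
by rewrite -scaler_suml c0 (negPf nz_j) scale0r linear0.
Qed.

Let p_pr : prime p := pcharf_prime k_char.

(** Polynomials of degree less than p with zero derivative are constant, and this
    determines q up to two constants. *)
Lemma pair_fixed (q : {poly k} * {poly k}) :
  (size q.1 <= p)%N -> (size q.2 <= p)%N ->
  pair_taylor 1 q = 0 ->
  q = ((q.1`_0)%:P, (q.2`_0)%:P - q.1`_0 *: 'X).
Proof.
have nz_nat j : (0 < j < p)%N -> j%:R != 0 :> k.
  by case/andP=> j0 ltjp; rewrite -(dvdn_pcharf k_char) gtnNdvd.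
case: q => q1 q2 /= sz1 sz2; rewrite pair_taylor1 => -[/= d1 d2].
have q1E : q1 = (q1`_0)%:P.
  apply/polyP => -[|j]; rewrite coefC //=.
  have [ltjp | lepj] := ltnP j.+1 p; last first.
    by rewrite nth_default ?(leq_trans sz1).
  have := congr1 (fun r : {poly k} => r`_j) d1.
  rewrite coef_deriv coef0 -mulr_natr => /eqP.
  by rewrite mulf_eq0 (negPf (nz_nat _ _)) // orbF => /eqP.
congr (_, _) => //; apply/polyP => -[|j].
  by rewrite coefB coefC coefZ coefX mulr0 subr0.
rewrite coefB coefC coefZ coefX /= sub0r.
have [ltjp | lepj] := ltnP j.+1 p; last first.
  rewrite nth_default ?(leq_trans sz2) //.
  by case: j lepj => [|j _]; [rewrite leqNgt prime_gt1 | rewrite mulr0 oppr0].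
have := congr1 (fun r : {poly k} => r`_j) d2.
rewrite coefD coef_deriv coef0 => /eqP; rewrite addr_eq0 -[_ *+ j.+1]mulr_natr.
case: j ltjp => [|j] ltjp; first by rewrite !mulr1 => /eqP.
have -> : q1`_j.+1 = 0 by rewrite q1E coefC.
rewrite oppr0 mulf_eq0 (negPf (nz_nat _ _)) // orbF => /eqP->.
by rewrite mulr0 oppr0.
Qed.

(** U contains the two coefficients of degree p - 1 and p of the orbit of w, which
    span the kernel of the coefficient of degree 1, and so all fixed vectors. A
    nonzero V would have a fixed vector too. *)
Lemma submod_top_no_complement (U V : 'M_(2 * p)) (w : 'rV[k]_(2 * p)) :
  mxmodule rG U -> mxmodule rG V -> (U :&: V)%MS = 0 ->
  (w <= U)%MS -> (pair_of_rV w).1`_p.-1 != 0 -> V = 0.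
Proof.
move=> modU modV UV0 wU nz_w; apply/eqP/contraT => nz_V.
have [v /andP[vV v_fix] nz_v] : exists2 v : 'rV_(2 * p),
    (v <= V)%MS && (v <= rfix_mx rG G)%MS & v != 0.
  have := rfix_pgroup_pchar k_char (submod_repr modV).
  move/(_ G); rewrite lt0n mxrank_eq0 => /(_ nz_V pG (subxx _)).
  rewrite -mxrank_eq0 (rfix_submod modV (subxx _)).
  rewrite mxrank_in_submod ?capmxSl // mxrank_eq0.
  by case/rowV0Pn=> v; rewrite sub_capmx => vVG nz_v; exists v.
have {}v_fix := rfix_mxP _ v_fix.
have p_gt0 := prime_gt0 p_pr.
have [szw1 szw2] := size_pair_of_rV w; have [szv1 szv2] := size_pair_of_rV v.
pose jp1 : 'I_p.+1 := inord p.-1.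
have jp1E : jp1 = p.-1 :> nat by rewrite inordK // ltnS leq_pred.
have [wp wpU fwp] := pair_taylor_submod ord_max modU wU.
have [w1 w1U fw1] := pair_taylor_submod jp1 modU wU.
set lam := (pair_of_rV w).1`_p.-1 in nz_w.
have {}fwp : pair_of_rV wp = (0, lam%:P).
  have := @pair_taylor_top k p.-1 (pair_of_rV w).
  by rewrite fwp prednK //; apply.
have fw1_1 : (pair_of_rV w1).1 = lam%:P.
  by rewrite fw1 jp1E /pair_taylor nderivn_top ?prednK.
(* The factor that appears in the composition of the coefficients of degree 1
   and p - 1 is p. *)
have fix_w1 : pair_taylor 1 (pair_of_rV w1) = 0.
  rewrite fw1 pair_taylor1_comp jp1E prednK // -scaler_nat (pcharf0 k_char).
  by rewrite scale0r.
have fix_v : pair_taylor 1 (pair_of_rV v) = 0.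
  have lt1p : (1 < p.+1)%N by rewrite ltnS.
  exact: (@pair_taylor_fix v (Ordinal lt1p) v_fix).
have [szw11 szw12] := size_pair_of_rV w1.
have := pair_fixed szv1 szv2 fix_v; have := pair_fixed szw11 szw12 fix_w1.
rewrite fw1_1 coefC /=.
set b := (pair_of_rV w1).2`_0; set c := (pair_of_rV v).1`_0.
set d := (pair_of_rV v).2`_0 => fw1E fvE.
have vE : lam *: v = c *: w1 + lam^-1 * (lam * d - c * b) *: wp.
  apply: pair_of_rV_inj; rewrite linearZ linearP linearZ /= fvE fw1E fwp.
  congr (_, _); rewrite /= -!mul_polyC; first by rewrite mulr0 addr0 mulrC.
  rewrite -[X in _ = _ + X]polyCM mulrAC mulVf // mul1r polyCB !polyCM; ring.
case/negP: nz_v; rewrite -submx0 -UV0 sub_capmx vV andbT.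
rewrite -(eqmx_scale v nz_w) vE.
by rewrite addmx_sub ?scalemx_sub.
Qed.

Lemma trans_prod_indecomposable : mx_indecomposable rG.
Proof.
have p_gt0 := prime_gt0 p_pr.
split=> [|U V modU modV UV1 UV0]; first by rewrite muln_gt0.
have [|//|w fw] := @pair_of_rV_onto k p ('X^(p.-1), 0); rewrite ?size_poly0 //.
  by rewrite size_polyXn prednK.
(* One of the components of x ⊗ x ^ (p - 1) in U and V keeps a nonzero top
   coefficient. *)
have : (w <= U + V)%MS by rewrite UV1 submx1.
case/sub_addsmxP=> -[u v] /= def_w.
have : (pair_of_rV (u *m U)).1`_p.-1 + (pair_of_rV (v *m V)).1`_p.-1 != 0.
  have := congr1 (fun q : {poly k} * {poly k} => q.1`_p.-1) fw.
  rewrite def_w linearD /= coefD coefXn eqxx => ->.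
  exact: oner_neq0.
have [-> | nz_u _] := eqVneq (pair_of_rV (u *m U)).1`_p.-1 0; last first.
  by right; apply: submod_top_no_complement modU modV UV0 (submxMl u U) nz_u.
rewrite add0r => nz_v; left; rewrite capmxC in UV0.
exact: submod_top_no_complement modV modU UV0 (submxMl v V) nz_v.
Qed.

End Indecomposable.

(** * Passage to the dual modules *)

Section Duals.

Local Open Scope ring_scope.

Variables (k : fieldType) (gT : finGroupType) (G : {group gT}).
Variables (rW : mx_representation k G 2) (a : gT -> k).
Hypothesis aD : {in G &, {morph a : g h / (g * h)%g >-> g + h}}.
Hypothesis simW : mx_rsim rW (trans_repr aD 2).

Lemma rsim_Vmod_trans i : mx_rsim (Vmod rW i) (dual_repr (trans_repr aD i)).
Proof.
case: i => [|i] /=; last exact/mx_rsim_dual/rsim_sym_trans.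
exists 1%:M => // [|g Gg]; first by rewrite row_free_unit unitmx1.
by rewrite [LHS]flatmx0 [RHS]flatmx0.
Qed.

Lemma rsim_prod_Vmod i :
  mx_rsim (prod_repr (Vmod rW 2) (Vmod rW i))
    (dual_repr (prod_repr (trans_repr aD 2) (trans_repr aD i))).
Proof.
apply: mx_rsim_trans (dual_prod2 _ _).
exact: mx_rsim_prod (rsim_Vmod_trans 2) (rsim_Vmod_trans i).
Qed.

Lemma rsim_dadd_Vmod i j :
  mx_rsim (dadd_grepr (Vmod rW i) (Vmod rW j))
    (dual_repr (dadd_grepr (Representation (trans_repr aD i))
                  (Representation (trans_repr aD j)))).
Proof.
apply: mx_rsim_trans (dual_dadd (Representation (trans_repr aD i))
                        (Representation (trans_repr aD j))).
exact: (@mx_rsim_dadd _ _ _ (Vmod rW i) (Representation _) (Vmod rW j)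
          (Representation _) (rsim_Vmod_trans i) (rsim_Vmod_trans j)).
Qed.

End Duals.

Theorem theorem1p1 (p n : nat) (k : fieldType) (gT : finGroupType)
    (G : {group gT}) (rW : mx_representation k G 2)
    (p_prime : prime p) (k_char : p \in [pchar k]%R)
    (n_ge1 : 1 <= n) (G_abelem : (p.-abelem G)%g) (G_order : #|G| = p ^ n)
    (W_faithful : mx_faithful rW) (W_indec : mx_indecomposable rW) :
  (forall i : nat, 1 <= i -> i < p ^ n -> ~~ (p %| i) ->
     mx_rsim (prod_repr (Vmod rW 2) (Vmod rW i))
             (dadd_grepr (Vmod rW i.+1) (Vmod rW i.-1)))
  /\ (1 < n -> mx_indecomposable (prod_repr (Vmod rW 2) (Vmod rW p))).
Proof.
have pG := abelem_pgroup G_abelem.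
have [a [aD [a_inj simW]]] := faithful2_rsim_trans k_char pG W_faithful.
split=> [i i_ge1 _ pNi | n_gt1].
  apply: mx_rsim_trans (rsim_prod_Vmod simW i) _.
  apply: mx_rsim_trans (mx_rsim_sym (rsim_dadd_Vmod simW i.+1 i.-1)).
  apply/mx_rsim_dual/trans_prod_rsim_dadd => //.
  by rewrite -(dvdn_pcharf k_char).
apply: mx_indecomposable_rsim (mx_rsim_sym (rsim_prod_Vmod simW p)) _.
apply/mx_indecomposable_dual/trans_prod_indecomposable => //.
have : p ^ 1 < p ^ n by rewrite ltn_exp2l // prime_gt1.
by rewrite expn1 G_order.
Qed.
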